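(* Let $n$ agents communicate over an undirected connected graph with adjacency matrix $A=[a_{ij}]\in\{0,1\}^{n\times n}$ and Laplacian $L=D-A$, where $D=\mathrm{diag}(d_1,\dots,d_n)$, $d_i=\sum_j a_{ij}$; let $\lambda_2(L)$ be the second smallest eigenvalue of $L$. Each agent $i$ has a bounded reference signal $r_i:[0,\infty)\to\mathbb{R}^m$ with bounded derivative $\dot r_i=f_i$. Each agent decomposes its data into two parts: vectors $r_i^\alpha(0),r_i^\beta(0)\in\mathbb{R}^m$ with $r_i^\alpha(0)+r_i^\beta(0)=2r_i(0)$, and bounded signals $f_i^\alpha,f_i^\beta$ with $f_i^\alpha(t)+f_i^\beta(t)=2f_i(t)$ for all $t$. The sub-states evolve as $$\begin{aligned} \dot x_i^\alpha(t)&=f_i^\alpha(t)+\kappa\sum_{j=1}^n a_{ij}\big(x_j^\alpha(t)-x_i^\alpha(t)\big)+\kappa\big(x_i^\beta(t)-x_i^\alpha(t)\big),\\ \dot x_i^\beta(t)&=f_i^\beta(t)+\kappa\big(x_i^\alpha(t)-x_i^\beta(t)\big),\\ x_i^\alpha(0)&=r_i^\alpha(0),\quad x_i^\beta(0)=r_i^\beta(0),\qquad i=1,\dots,n, \end{aligned}$$ with a constant $\kappa>0$. Then all sub-states $x_i^\alpha,x_i^\beta$ are input-to-state stable, and the tracking errors $x_i^\alpha(t)-\frac1n\sum_{j=1}^n r_j(t)$ and $x_i^\beta(t)-\frac1n\sum_{j=1}^n r_j(t)$ are ultimately bounded. Moreover, the convergence rate of the tracking errors (to their ultimate bound) is no worse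 than $\frac{\kappa}{2}\Big(\lambda_2(L)+2-\sqrt{\lambda_2^2(L)+4}\Big)$.
   Context: Input-to-state stability and ultimate boundedness are in the standard sense (inputs being the reference-derivative signals). ''Convergence rate no worse than $c$'' means the tracking errors approach their ultimate bound exponentially with exponent at least $c$.
   Formalization: Sub-states are not literally input-to-state stable (constant r_i=1 with zero inputs keeps every sub-state at 1), so this clause is stated as boundedness of the sub-states plus an ISS estimate for the tracking errors with inputs f_i^α, f_i^β. *)

(* Defs.v *)
From HB Require Import structures.
From mathcomp Require Import all_boot all_order all_algebra.
From mathcomp Require Import all_classical all_reals all_analysis.
Set Implicit Arguments. Unset Strict Implicit. Unset Printing Implicit Defensive.
Import Order.TTheory GRing.Theory Num.Theory.
Import numFieldNormedType.Exports.
Local Open Scope classical_set_scope.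
Local Open Scope ring_scope.

Definition laplacian (R : realType) (n : nat) (A : 'M[R]_n) : 'M[R]_n :=
  diag_mx (\row_i (\sum_j A i j)) - A.

Definition undirected_adjacency (R : realType) (n : nat) (A : 'M[R]_n) : Prop :=
  (forall i j, A i j = 0 \/ A i j = 1) /\ (forall i j, A i j = A j i).

Definition connected_graph (R : realType) (n : nat) (A : 'M[R]_n) : Prop :=
  forall i j : 'I_n, connect [rel k l | A k l == 1] i j.

(* l is the second smallest eigenvalue (counted with multiplicity) of M:
   s is the sorted list of the eigenvalues with multiplicity, i.e. the roots
   of the characteristic polynomial, and l = s_2 (index 1). *)
Definition second_smallest_eigenvalue (R : realType) (n : nat) (M : 'M[R]_n)
  (l : R) : Prop :=
  exists s : seq R, sorted <=%R s /\
    char_poly M = \prod_(x <- s) ('X - x%:P) /\ l = s`_1.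

Definition classK (R : realType) (g : R -> R) : Prop :=
  g 0 = 0 /\ {within [set x : R | 0 <= x], continuous g} /\
  (forall a b : R, 0 <= a -> a < b -> g a < g b).

Definition ravg (R : realType) (n m : nat) (r : 'I_n -> 'I_m -> R -> R)
  (k : 'I_m) (t : R) : R := (n%:R)^-1 * \sum_(j < n) r j k t.

(* Main.v *)
Require Import Defs.
From HB Require Import structures.
From mathcomp Require Import all_boot all_order all_algebra.
From mathcomp Require Import all_classical all_reals all_analysis.
From mathcomp Require Import ring lra.
Import Order.TTheory GRing.Theory Num.Theory.
Import numFieldNormedType.Exports.
Local Open Scope classical_set_scope.
Local Open Scope ring_scope.

(* The errors with respect to the reference average sum to zero: their sum has
   zero derivative and, by the two decomposition conditions, zero initial value.
   On such vectors the coupled Laplacian form a^T L a + |a - b|^2 dominates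
   c (|a|^2 + |b|^2), where c is the smallest eigenvalue of
   [[l2 + 1, -1], [-1, 1]]: the means of a and b are opposite, hence controlled
   by |a - b|^2, and on mean-free vectors L is bounded below by l2.
   Hence V = |a|^2 + |b|^2 satisfies V' <= 2 (G sqrt V - kappa c V), and sqrt V decays at rate kappa c up to
   G / (kappa c).
   The Rayleigh bound comes from a minimizer on the unit sphere of 1^perp, which
   is an eigenvector for a nonzero eigenvalue; l2 is positive and at most
   that eigenvalue because 0 is a simple root of the characteristic
   polynomial. *)

(** * Euclidean inner product on row vectors *)

Definition dot {R : realType} {n : nat} (u v : 'rV[R]_n) : R :=
  \sum_i u 0 i * v 0 i.

Lemma dotC {R : realType} {n : nat} (u v : 'rV[R]_n) : dot u v = dot v u.
Proof. by apply: eq_bigr => i _; rewrite mulrC. Qed.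

Lemma dotDl {R : realType} {n : nat} (u v w : 'rV[R]_n) :
  dot (u + v) w = dot u w + dot v w.
Proof. by rewrite -big_split; apply: eq_bigr => i _; rewrite mxE mulrDl. Qed.

Lemma dotDr {R : realType} {n : nat} (u v w : 'rV[R]_n) :
  dot w (u + v) = dot w u + dot w v.
Proof. by rewrite !(dotC w) dotDl. Qed.

Lemma dotZl {R : realType} {n : nat} (a : R) (u v : 'rV[R]_n) :
  dot (a *: u) v = a * dot u v.
Proof. by rewrite mulr_sumr; apply: eq_bigr => i _; rewrite mxE mulrA. Qed.

Lemma dotZr {R : realType} {n : nat} (a : R) (u v : 'rV[R]_n) :
  dot u (a *: v) = a * dot u v.
Proof. by rewrite !(dotC u) dotZl. Qed.

Lemma dot_ge0 {R : realType} {n : nat} (u : 'rV[R]_n) : 0 <= dot u u.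
Proof. by apply: sumr_ge0 => i _; rewrite -expr2 sqr_ge0. Qed.

Lemma dot_eq0 {R : realType} {n : nat} (u : 'rV[R]_n) : dot u u = 0 -> u = 0.
Proof.
move=> u0; apply/rowP => i; rewrite mxE; apply/eqP.
rewrite -[_ == 0]orbb -mulf_eq0; apply/eqP/(psumr_eq0P _ u0) => // j _.
by rewrite -expr2 sqr_ge0.
Qed.

Lemma dot_mulmx {R : realType} {n : nat} (M : 'M[R]_n) (u v : 'rV[R]_n) :
  dot (u *m M) v = dot u (v *m M^T).
Proof.
have dotE (x y : 'rV[R]_n) : dot x y = (x *m y^T) 0 0.
  by rewrite mxE; apply: eq_bigr => i _; rewrite mxE.
by rewrite !dotE trmx_mul trmxK mulmxA.
Qed.

Lemma dot_const {R : realType} {n : nat} (a : R) (v : 'rV[R]_n) :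
  dot (const_mx a) v = a * \sum_i v 0 i.
Proof. by rewrite mulr_sumr; apply: eq_bigr => i _; rewrite mxE. Qed.

(** * The quadratic form of the graph Laplacian *)

Lemma mul_laplacian {R : realType} {n : nat} (A : 'M[R]_n) (v : 'rV[R]_n) j :
  undirected_adjacency A ->
  (v *m laplacian A) 0 j = \sum_i A i j * (v 0 j - v 0 i).
Proof.
move=> [_ Asym]; rewrite /laplacian mulmxBr mul_mx_diag !mxE.
rewrite mulr_sumr -sumrB; apply: eq_bigr => i _.
by rewrite (Asym j i) mulrBr mulrC [v 0 i * _]mulrC.
Qed.

Lemma laplacian_tr {R : realType} {n : nat} (A : 'M[R]_n) :
  undirected_adjacency A -> (laplacian A)^T = laplacian A.
Proof.
move=> [_ Asym]; rewrite /laplacian linearB /= tr_diag_mx; congr (_ - _).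
by apply/matrixP => i j; rewrite mxE.
Qed.

(** The constant vector lies in the kernel of the Laplacian, which is self-adjoint. *)
Lemma sum_mul_laplacian {R : realType} {n : nat} (A : 'M[R]_n) (v : 'rV[R]_n) :
  undirected_adjacency A -> \sum_j (v *m laplacian A) 0 j = 0.
Proof.
move=> Aund; have := dot_const 1 (v *m laplacian A); rewrite mul1r => <-.
rewrite dotC dot_mulmx laplacian_tr //.
rewrite /dot big1 // => j _; rewrite mul_laplacian // big1 ?mulr0 // => i _.
by rewrite !mxE subrr mulr0.
Qed.

(** Exchanging the two summation indices and using the symmetry of [A], the terms for [(i, j)] and
    [(j, i)] add up to a square; hence the factor 2. *)
Lemma laplacian_form {R : realType} {n : nat} (A : 'M[R]_n) (v : 'rV[R]_n) :
  undirected_adjacency A ->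
  dot (v *m laplacian A) v *+ 2 = \sum_j \sum_i A i j * (v 0 j - v 0 i) ^+ 2.
Proof.
move=> Aund; have -> : dot (v *m laplacian A) v =
    \sum_j \sum_i A i j * (v 0 j - v 0 i) * v 0 j.
  by apply: eq_bigr => j _; rewrite mul_laplacian // mulr_suml.
rewrite mulr2n [X in X + _]exchange_big -big_split; apply: eq_bigr => j _.
rewrite -big_split; apply: eq_bigr => i _ /=.
by rewrite (Aund.2 j i); ring.
Qed.

Lemma laplacian_form_ge0 {R : realType} {n : nat} (A : 'M[R]_n) (v : 'rV[R]_n) :
  undirected_adjacency A -> 0 <= dot (v *m laplacian A) v.
Proof.
move=> Aund; rewrite -(pmulrn_lge0 _ (isT : (0 < 2)%N)) laplacian_form //.
apply: sumr_ge0 => j _; apply: sumr_ge0 => i _; rewrite mulr_ge0 ?sqr_ge0 //.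
by case: (Aund.1 i j) => ->.
Qed.

(** A vanishing sum of squares makes [v] equal at the ends of every edge, hence constant along
    paths; the zero sum then leaves only the constant 0. *)
Lemma laplacian_form_eq0 {R : realType} {n : nat} (A : 'M[R]_n) (v : 'rV[R]_n) :
  undirected_adjacency A -> connected_graph A ->
  dot (v *m laplacian A) v = 0 -> \sum_i v 0 i = 0 -> v = 0.
Proof.
move=> Aund Acon vLv v0; have := laplacian_form A v Aund.
rewrite vLv mul0rn => /esym form0.
have Age0 i j : 0 <= A i j by case: (Aund.1 i j) => ->.
have term_ge0 i j : 0 <= A i j * (v 0 j - v 0 i) ^+ 2.
  by rewrite mulr_ge0 ?sqr_ge0.
have edge_eq i j : A i j == 1 -> v 0 i = v 0 j.
  move=> /eqP Aij; have := psumr_eq0P (fun j _ => sumr_ge0 _ _) form0.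
  move=> /(_ (fun j i _ => term_ge0 i j) j isT).
  move=> /(psumr_eq0P (fun i _ => term_ge0 i j)) /(_ i isT) /eqP.
  by rewrite Aij mul1r sqrf_eq0 subr_eq0 => /eqP.
have vconst i j : v 0 i = v 0 j.
  have /connectP [p] := Acon i j.
  elim: p i => [|k p IHp] i /=; first by move=> _ ->.
  by move=> /andP[/edge_eq -> /IHp]; apply.
apply/rowP => i; rewrite mxE.
move: v0; rewrite (eq_bigr (fun=> v 0 i)) => [|j _]; last exact: vconst.
rewrite sumr_const card_ord => /eqP; rewrite mulrn_eq0 => /orP[/eqP n0|/eqP//].
by have := leq_ltn_trans (leq0n i) (ltn_ord i); rewrite lt0n => /eqP.
Qed.

(** * Characteristic polynomial of the Laplacian *)

Lemma laplacian_eigenvalue_ge0 {R : realType} {n : nat} (A : 'M[R]_n) (x : R) :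
  undirected_adjacency A -> root (char_poly (laplacian A)) x -> 0 <= x.
Proof.
move=> Aund; rewrite -eigenvalue_root_char => /eigenvalueP[v vL v0].
have := laplacian_form_ge0 A v Aund; rewrite vL dotZl pmulr_lge0 //.
by rewrite lt0r dot_ge0 andbT; apply: contra_neq v0; exact: dot_eq0.
Qed.

(** Zero row sums give the factor ['X], and connectedness makes it occur only once. The form is
    polynomial because [second_smallest_eigenvalue] counts roots with multiplicity. *)
Lemma char_poly_laplacian {R : realType} {n : nat} (A : 'M[R]_n.+1) :
  undirected_adjacency A -> connected_graph A ->
  exists2 q : {poly R}, char_poly (laplacian A) = 'X * q & ~~ root q 0.
Proof.
move=> Aund Acon.
have [L LE] : {L | L = laplacian A} by exists (laplacian A).
rewrite -LE.
have Lsum (v : 'rV_n.+1) : \sum_j (v *m L) 0 j = 0 by rewrite LE sum_mul_laplacian.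
have Lrow i : \sum_k L i k = 0.
  rewrite -[RHS](Lsum (delta_mx 0 i)).
  by apply: eq_bigr => k _; rewrite -rowE mxE.
(* Adding all columns of ['X - L] to the first one turns it into ['X * 1]. *)
pose P : 'M[{poly R}]_n.+1 := \matrix_(i, j) if j == 0 then 1 else (i == j)%:R.
pose N : 'M[{poly R}]_n.+1 :=
  \matrix_(i, j) if j == 0 then 1 else char_poly_mx L i j.
pose D : 'rV[{poly R}]_n.+1 := \row_j if j == 0 then 'X else 1.
have LP : char_poly_mx L *m P = N *m diag_mx D.
  apply/matrixP => i j; rewrite mul_mx_diag !mxE.
  have [->|j0] := eqVneq j 0.
    under eq_bigr do rewrite !mxE /= mulr1.
    rewrite sumrB -rmorph_sum /= (bigD1 i) //= eqxx big1 ?addr0; last first.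
      by move=> k; rewrite eq_sym => /negbTE ->.
    by rewrite Lrow subr0 mul1r.
  under eq_bigr do rewrite !mxE (negbTE j0).
  rewrite (bigD1 j) //= eqxx !mulr1 big1 ?addr0 // => k /negbTE ->.
  by rewrite mulr0.
have detP : \det P = 1.
  rewrite det_trig; last first.
    apply/is_trig_mxP => i j ij; rewrite mxE ifF; last first.
      by apply: contraTF ij => /eqP ->; rewrite ltn0.
    by case: eqP ij => // ->; rewrite ltnn.
  by rewrite big1 // => i _; rewrite mxE eqxx if_same.
have detD : \det (diag_mx D) = 'X.
  rewrite det_diag (bigD1 0) //= mxE eqxx big1 ?mulr1 // => i /negbTE i0.
  by rewrite mxE i0.
exists (\det N).
  by rewrite /char_poly -[LHS]mulr1 -detP -det_mulmx LP det_mulmx detD mulrC.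
(* A root of [\det N] at 0 would give a nonzero [v] in the left kernel of [N] at 0: the first column
   says that the entries of [v] sum to 0, each other column that the corresponding entry of [v *m L]
   is 0. *)
rewrite /root -horner_evalE -det_map_mx; apply/det0P => -[v v0 vN].
have vN0 j : \sum_i v 0 i * (N i j).[0] = 0.
  by have /rowP/(_ j) := vN; rewrite !mxE; under eq_bigr do rewrite mxE.
have sumv : \sum_i v 0 i = 0.
  have := vN0 0; under eq_bigr do rewrite mxE eqxx /= hornerC mulr1.
  by [].
have vL j : j != 0 -> (v *m L) 0 j = 0.
  move=> /negbTE j0; apply: oppr_inj; rewrite oppr0 -[RHS](vN0 j) mxE -sumrN.
  apply: eq_bigr => i _; rewrite 2!mxE j0 mxE hornerD hornerMn hornerX mul0rn.
  by rewrite !mxE hornerN hornerC add0r mulrN.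
(* The first entry follows from the others, as the entries of [v *m L] sum to 0. *)
have vL0 : v *m L = 0.
  apply/rowP => j; rewrite [RHS]mxE.
  have [->|/vL //] := eqVneq j 0.
  have := Lsum v; rewrite (bigD1 0) //= big1 ?addr0 //.
move/eqP: v0; apply; apply: (laplacian_form_eq0 A) => //.
by rewrite -LE vL0 /dot big1 // => i _; rewrite mxE mul0r.
Qed.

(** * Rayleigh quotient and spectral gap *)

Lemma continuous_sum {R : realType} {T : topologicalType} {n : nat}
    (F : 'I_n -> T -> R) :
  (forall i, continuous (F i)) -> continuous (fun x => \sum_i F i x).
Proof.
by move=> cF; apply: continuous_big => [|i _]; [exact: add_continuous|exact: cF].
Qed.

Lemma dot_normalized {R : realType} {n : nat} (v : 'rV[R]_n) : v != 0 ->
  dot ((Num.sqrt (dot v v))^-1 *: v) ((Num.sqrt (dot v v))^-1 *: v) = 1.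
Proof.
move=> v0; have vv : dot v v != 0 by apply: contra_neq v0; exact: dot_eq0.
by rewrite dotZl dotZr mulrA -expr2 exprVn sqr_sqrtr ?dot_ge0// mulVf.
Qed.

(** By compactness the form attains a minimum on the mean-free unit sphere, and minimality makes the
    residual [u *m L - mu *: u] vanish. The zero-sum hypothesis on [L] keeps this residual
    mean-free, hence an admissible direction. *)
Lemma rayleigh_min {R : realType} {n : nat} (L : 'M[R]_n) :
  (1 < n)%N -> L^T = L -> (forall v : 'rV_n, \sum_j (v *m L) 0 j = 0) ->
  exists mu : R, exists u : 'rV[R]_n,
    [/\ u != 0, \sum_i u 0 i = 0, u *m L = mu *: u &
      forall v : 'rV_n, \sum_i v 0 i = 0 -> mu * dot v v <= dot (v *m L) v].
Proof.
move=> n_gt1 Lsym Lsum.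
pose S := [set v : 'rV[R]_n | \sum_i v 0 i = 0 /\ dot v v = 1].
have csum : continuous (fun v : 'rV[R]_n => \sum_i v 0 i).
  by apply: continuous_sum => i; exact: coord_continuous.
have cdot (M : 'M[R]_n) : continuous (fun v : 'rV[R]_n => dot (v *m M) v).
  have cM i : continuous (fun v : 'rV[R]_n => (v *m M) 0 i).
    under eq_fun do rewrite mxE; apply: continuous_sum => k v.
    by apply: continuousM; [exact: coord_continuous|exact: cst_continuous].
  apply: continuous_sum => i v.
  by apply: continuousM; [exact: cM|exact: coord_continuous].
have cdot1 : continuous (fun v : 'rV[R]_n => dot v v).
  by have := cdot 1%:M; under eq_fun do rewrite mulmx1.
(* The normalized difference of two basis vectors is mean-free; this uses [1 < n]. *)
have S0 : S !=set0.
  pose i0 := Ordinal (ltnW n_gt1); pose i1 := Ordinal n_gt1.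
  pose d : 'rV[R]_n := delta_mx 0 i0 - delta_mx 0 i1.
  have d0 : d != 0.
    by apply/eqP => /rowP/(_ i0)/eqP; rewrite !mxE !eqxx subr0 oner_eq0.
  have dsum i : \sum_j (delta_mx 0 i : 'rV[R]_n) 0 j = 1.
    rewrite (bigD1 i) //= mxE !eqxx big1 ?addr0 // => j /negbTE ji.
    by rewrite mxE ji.
  exists ((Num.sqrt (dot d d))^-1 *: d); split; last exact: dot_normalized.
  under eq_bigr do rewrite mxE; rewrite -mulr_sumr.
  under eq_bigr do rewrite mxE [X in _ + X]mxE.
  by rewrite sumrB !dsum subrr mulr0.
have cS : compact S.
  apply: bounded_closed_compact.
    exists 1; split => // M M1 v [_ vv]; apply: le_trans (ltW M1).
    rewrite [leLHS]/Num.norm /= mx_normrE; apply/bigmax_leP; split => //=.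
    move=> -[i j] _ /=.
    rewrite (ord1 i) -(@ler_pXn2r _ 2) ?nnegrE // expr1n real_normK ?num_real //.
    rewrite -vv /dot (bigD1 j) //= expr2 lerDl; apply: sumr_ge0 => k _.
    by rewrite -expr2 sqr_ge0.
  apply: closedI.
    by apply: (@preimage_closed _ _ (fun v : 'rV[R]_n => \sum_i v 0 i) [set 0])
      => [v _|]; [exact: csum|exact: closed_eq].
  by apply: (@preimage_closed _ _ (fun v : 'rV[R]_n => dot v v) [set 1])
    => [v _|]; [exact: cdot1|exact: closed_eq].
have [u] := EVT_min_rV S0 cS (continuous_subspaceT (cdot L)).
rewrite inE => -[usum uu] umin.
pose mu := dot (u *m L) u.
have mu_min (v : 'rV_n) : \sum_i v 0 i = 0 -> mu * dot v v <= dot (v *m L) v.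
  move=> vsum; have [->|v0] := eqVneq v 0.
    by rewrite mul0mx -(scale0r 0) !dotZl mul0r mulr0.
  have vv : 0 < dot v v.
    by rewrite lt0r dot_ge0 andbT; apply: contra_neq v0; exact: dot_eq0.
  have := umin ((Num.sqrt (dot v v))^-1 *: v).
  rewrite inE -scalemxAl dotZl dotZr mulrA -expr2 exprVn sqr_sqrtr ?dot_ge0 //.
  rewrite -/mu ler_pdivlMl // mulrC; apply; split; last exact: dot_normalized.
  by under eq_bigr do rewrite mxE; rewrite -mulr_sumr vsum mulr0.
exists mu, u; split => //.
  by apply: contra_eq_neq uu => ->; rewrite -(scale0r 0) dotZl mul0r eq_sym oner_eq0.
(* First variation of the Rayleigh quotient at [u], in the direction [w]. *)
have [w wE] : {w : 'rV_n | w = u *m L - mu *: u} by exists (u *m L - mu *: u).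
have wsum : \sum_i w 0 i = 0.
  transitivity (\sum_i (u *m L) 0 i - mu * \sum_i u 0 i).
    rewrite mulr_sumr -sumrB; apply: eq_bigr => i _.
    by rewrite wE mxE [X in _ + X]mxE [X in - X]mxE.
  by rewrite Lsum usum mulr0 subr0.
(* In [mu_min] at [u + t *: w] the constant terms cancel; the coefficient of [t] comes from
   [dot (u *m L) w - mu * dot u w = dot w w]. *)
have var t : 0 <= t * (2 * dot w w) + t ^+ 2 * (dot (w *m L) w - mu * dot w w).
  have := mu_min (u + t *: w) _.
  have -> : \sum_i (u + t *: w) 0 i = 0.
    under eq_bigr do rewrite mxE [X in _ + X]mxE.
    by rewrite big_split /= -mulr_sumr usum wsum mulr0 addr0.
  move=> /(_ erefl); rewrite mulmxDl -scalemxAl !dotDl !dotDr !dotZl !dotZr.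
  rewrite uu -/mu (dotC w u) [dot (w *m L) u]dot_mulmx Lsym (dotC w (u *m L)).
  have -> : dot (u *m L) w = dot w w + mu * dot u w.
    by rewrite {2}wE dotDl -scaleNr dotZl mulNr subrK.
  rewrite -subr_ge0 => /le_trans; apply; rewrite le_eqVlt; apply/orP; left.
  apply/eqP; ring.
apply/eqP; rewrite -subr_eq0; apply/eqP/dot_eq0; rewrite -wE.
apply: le_anti; rewrite dot_ge0 andbT.
set b := dot w w in var *; set c := _ - mu * b in var.
rewrite leNgt; apply/negP => b0.
have c0 : 0 < 1 + `|c| by rewrite ltr_pwDl.
(* For small negative [t] the linear term wins: at [t = - k] the bound reads
   [0 <= k * (k * c - 2 * b)], while [k * c < b]. *)
have := var (- (b / (1 + `|c|))).
rewrite leNgt => /negP; apply.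
set k := b / (1 + `|c|); have k0 : 0 < k by rewrite divr_gt0.
have kc : k * c < b.
  rewrite -[ltRHS](divfK (lt0r_neq0 c0)) -/k ltr_pM2l //.
  rewrite (le_lt_trans (ler_norm c)) //.
  by rewrite ltrDr.
nra.
Qed.

Lemma laplacian_spectral_gap {R : realType} {n : nat} (A : 'M[R]_n) (l2 : R) :
  (1 < n)%N -> undirected_adjacency A -> connected_graph A ->
  second_smallest_eigenvalue (laplacian A) l2 ->
  0 < l2 /\ forall v : 'rV_n, \sum_i v 0 i = 0 ->
    l2 * dot v v <= dot (v *m laplacian A) v.
Proof.
case: n A => [//|n] A n_gt1 Aund Acon [s [s_sorted [sE ->]]].
have [q qE q0] := char_poly_laplacian A Aund Acon.
have rootE x : root (char_poly (laplacian A)) x = (x \in s).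
  by rewrite sE root_prod_XsubC.
have s_ge0 x : x \in s -> 0 <= x.
  by rewrite -rootE; exact: laplacian_eigenvalue_ge0.
have s0 : 0 \in s by rewrite -rootE qE rootM rootX eqxx.
(* Lists with fewer than two entries, where index 1 would return the default 0, are excluded: 0 is a
   root, and the degree exceeds 1. *)
case: s => [|x [|y s]] /= in s_sorted sE rootE s_ge0 s0 *; first by [].
  have := size_char_poly (laplacian A); rewrite sE size_prod_XsubC => -[n0].
  by rewrite -n0 in n_gt1.
have /andP[xy ys] := s_sorted.
have s_min z : z \in y :: s -> y <= z.
  rewrite inE => /orP[/eqP -> //|zs].
  by have /allP := order_path_min le_trans ys; exact.
have x0 : x = 0.
  apply/le_anti; rewrite s_ge0 ?mem_head // andbT.
  move: s0; rewrite inE => /orP[/eqP <- //|/s_min]; exact: le_trans.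
(* Cancelling ['X] against the first entry leaves [q], which does not vanish at 0; so all later
   entries are nonzero. *)
have {}qE : q = \prod_(z <- y :: s) ('X - z%:P).
  apply: (mulfI (negbT (polyX_eq0 R))).
  by rewrite -qE sE big_cons x0 subr0.
have root_q z : z \in y :: s -> z != 0.
  by apply: contraTneq => ->; rewrite -root_prod_XsubC -qE.
have y_gt0 : 0 < y.
  by rewrite lt0r root_q ?mem_head // s_ge0 // !inE eqxx orbT.
split=> // v vsum.
have [mu [u [u0 usum uL mu_min]]] := rayleigh_min (laplacian A) n_gt1
  (laplacian_tr A Aund) (fun v => sum_mul_laplacian A v Aund).
apply: le_trans (mu_min v vsum); rewrite ler_wpM2r ?dot_ge0 //; apply: s_min.
(* If [mu] were the first entry 0, the form would vanish at the mean-free [u], forcing [u = 0]; so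
   [mu] occurs later in the list. *)
have mu_s : mu \in x :: y :: s.
  by rewrite -rootE -eigenvalue_root_char; apply/eigenvalueP; exists u.
move: mu_s; rewrite inE => /orP[/eqP mux|//].
case/eqP: u0; apply: (laplacian_form_eq0 A) => //.
by rewrite uL mux x0 dotZl mul0r.
Qed.

(** * Coercivity of the coupled quadratic form *)

(* [c] is the smaller root of [(l + 1 - c) (1 - c) = 1], i.e. the smallest
   eigenvalue of [[l + 1, -1], [-1, 1]]. *)
Lemma coupling_rate_spec {R : realType} (l : R) : 0 < l ->
  let c := (l + 2 - Num.sqrt (l ^+ 2 + 4)) / 2 in
  [/\ 0 < c, c < 1 & (l + 1 - c) * (1 - c) = 1].
Proof.
move=> l0 c; rewrite /c; set s := Num.sqrt _.
have s0 : 0 <= s := sqrtr_ge0 _.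
have s2 : s ^+ 2 = l ^+ 2 + 4 by rewrite sqr_sqrtr // addr_ge0 ?sqr_ge0.
split; [nra|nra|].
have -> : (l + 1 - (l + 2 - s) / 2) * (1 - (l + 2 - s) / 2) =
    (s ^+ 2 - l ^+ 2) / 4.
  by field.
by rewrite s2; field.
Qed.

(** Split off the means [h] and [- h]. On the mean-free parts the gap reduces the claim to the
    matrix [[[l + 1 - c, -1], [-1, 1 - c]]], positive semidefinite since its determinant is 0 and
    its diagonal positive; the constant parts contribute [4 |e|^2] against [2 c |e|^2]. *)
Lemma coupled_form_ge {R : realType} {n : nat} (A : 'M[R]_n) (l c : R)
    (a b : 'rV[R]_n) :
  (0 < n)%N -> undirected_adjacency A ->
  (forall v : 'rV_n, \sum_i v 0 i = 0 ->
    l * dot v v <= dot (v *m laplacian A) v) ->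
  0 < l -> c < 1 -> (l + 1 - c) * (1 - c) = 1 ->
  \sum_i a 0 i + \sum_i b 0 i = 0 ->
  c * (dot a a + dot b b) <= dot (a *m laplacian A) a + dot (a - b) (a - b).
Proof.
move=> n0 Aund gap l0 c1 cE ab0.
have n0R : n%:R != 0 :> R by rewrite pnatr_eq0 -lt0n.
pose h : R := (\sum_i a 0 i) / n%:R.
have sumc (t : R) : \sum_(i < n) (const_mx t : 'rV_n) 0 i = t * n%:R.
  under eq_bigr do rewrite mxE.
  by rewrite sumr_const card_ord mulr_natr.
pose e : 'rV[R]_n := const_mx h.
have [a' aE] : {a' : 'rV_n | a = a' + e} by exists (a - e); rewrite subrK.
have [b' bE] : {b' : 'rV_n | b = b' - e} by exists (b + e); rewrite addrK.
have a'0 : \sum_i a' 0 i = 0.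
  have : \sum_i a 0 i = \sum_i a' 0 i + h * n%:R.
    by rewrite -sumc -big_split; apply: eq_bigr => i _; rewrite aE mxE.
  by rewrite divfK // -[LHS]add0r => /addIr.
have b'0 : \sum_i b' 0 i = 0.
  have : \sum_i b 0 i = \sum_i b' 0 i - h * n%:R.
    by rewrite -sumc -sumrB; apply: eq_bigr => i _; rewrite bE mxE [X in _ + X]mxE.
  rewrite divfK // => bsum; move: ab0; rewrite bsum addrC subrK //.
have eL : e *m laplacian A = 0.
  apply/rowP => j; rewrite mul_laplacian // [RHS]mxE big1 // => i _.
  by rewrite !mxE subrr mulr0.
have ea (v : 'rV_n) : \sum_i v 0 i = 0 -> dot e v = 0.
  by rewrite dot_const => ->; rewrite mulr0.
have ee : 0 <= dot e e := dot_ge0 e.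
have -> : dot (a *m laplacian A) a = dot (a' *m laplacian A) a'.
  by rewrite aE mulmxDl eL addr0 dotDr [X in _ + X]dotC ea ?sum_mul_laplacian ?addr0.
have -> : dot a a = dot a' a' + dot e e.
  by rewrite aE dotDr !dotDl (dotC a' e) (ea a') // addr0 add0r.
have -> : dot b b = dot b' b' + dot e e.
  rewrite bE -scaleN1r !(dotDr, dotDl, dotZl, dotZr) (dotC b' e) (ea b') //; ring.
have -> : dot (a - b) (a - b) = dot a' a' - 2 * dot a' b' + dot b' b' + 4 * dot e e.
  rewrite aE bE -scaleN1r -[- e]scaleN1r !(dotDr, dotDl, dotZl, dotZr).
  rewrite (dotC a' e) (dotC b' e) (dotC b' a') (ea a') // (ea b') //; ring.
have := gap a' a'0; set p := l + 1 - c in cE *.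
have p0 : 0 < p by rewrite /p; lra.
(* As [p * (1 - c) = 1], this square is [p] times the 2 by 2 form in [a'] and [b']. *)
have := dot_ge0 (p *: a' - b').
rewrite -scaleN1r !(dotDr, dotDl, dotZl, dotZr) (dotC b' a') => sq gapa.
have : 0 <= p * (dot a' a') - 2 * dot a' b' + (1 - c) * dot b' b'.
  rewrite -(pmulr_rge0 _ p0); apply: le_trans sq _; rewrite le_eqVlt; apply/orP; left.
  apply/eqP; rewrite !mulrDr [p * ((1 - c) * _)]mulrA cE; ring.
rewrite /p; nra.
Qed.

(** * Calculus on the half-line and a Gronwall estimate *)

Lemma within_ge0_segment {R : realType} (f : R -> R) (t : R) :
  {within [set s : R | 0 <= s], continuous f} -> {within `[0, t], continuous f}.
Proof. by apply: continuous_subspaceW => s /=; rewrite in_itv /= => /andP[]. Qed.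

Lemma is_derive_bigsum {R : realType} {n : nat} (h : 'I_n -> R -> R)
    (dh : 'I_n -> R) (x : R) :
  (forall i, is_derive x 1 (h i) (dh i)) ->
  is_derive x 1 (fun s => \sum_i h i s) (\sum_i dh i).
Proof.
move=> dhx; rewrite (_ : (fun s => _) = \sum_i h i); first exact: is_derive_sum.
by apply/funext => s; rewrite fct_sumE.
Qed.

Lemma within_continuous_sum {R : realType} {n : nat} (D : set R)
    (h : 'I_n -> R -> R) :
  (forall i, {within D, continuous (h i)}) ->
  {within D, continuous (fun s => \sum_i h i s)}.
Proof. by move=> ch; apply: continuous_sum => i; exact: ch. Qed.

(* [sqrt V] need not be differentiable where [V] vanishes, so the Gronwall
   argument is run on [sqrt (V + e ^+ 2)]. *)
Lemma sqrt_decay {R : realType} (V dV : R -> R) (c G t : R) :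
  0 < c -> 0 <= G -> 0 <= t -> (forall s, 0 <= V s) ->
  {within [set s : R | 0 <= s], continuous V} ->
  (forall s, 0 < s < t -> is_derive s 1 V (dV s)) ->
  (forall s, 0 < s < t -> dV s <= 2 * (G * Num.sqrt (V s) - c * V s)) ->
  Num.sqrt (V t) <= expR (- (c * t)) * Num.sqrt (V 0) + G / c.
Proof.
move=> c0 G0 t0 V0 cV dVE dV_le; apply/ler_addgt0Pr => e2 e20.
pose e := e2 / 2; have e0 : 0 < e by rewrite divr_gt0.
pose W s := Num.sqrt (V s + e ^+ 2).
have Ve s : 0 < V s + e ^+ 2 by rewrite ltr_wpDl ?exprn_gt0.
have W2 s : W s ^+ 2 = V s + e ^+ 2 by rewrite sqr_sqrtr // ltW.
have W0 s : 0 < W s by rewrite sqrtr_gt0.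
have We s : e <= W s.
  by rewrite -(ger0_norm (ltW e0)) -sqrtr_sqr /W ler_wsqrtr // lerDr.
have VW s : Num.sqrt (V s) <= W s by rewrite /W ler_wsqrtr // lerDl sqr_ge0.
have WV s : W s <= Num.sqrt (V s) + e.
  rewrite -(@ler_pXn2r _ 2) ?nnegrE ?addr_ge0 ?sqrtr_ge0 ?(ltW e0) ?(ltW (W0 s)) //.
  by rewrite W2 sqrrD sqr_sqrtr // lerD2r lerDl mulrn_wge0 // mulr_ge0 ?sqrtr_ge0 // ltW.
(* Integrating factor: from [V / W = W - e ^+ 2 / W] and [e <= W] one gets
   [W' <= G + c * e - c * W], whose equilibrium is [G / c + e]; so [F] does not increase. *)
pose F s := expR (c * s) * (W s - (G / c + e)).
pose dF s := expR (c * s) * (c * (W s - (G / c + e)) + dV s / (2 * W s)).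
have dFE s : s \in `]0, t[%R -> is_derive s 1 F (dF s).
  rewrite in_itv /= => st; have dVs := dVE s st.
  have dWs : is_derive s 1 W (dV s / (2 * W s)).
    have dVes : is_derive s 1 (fun x => V x + e ^+ 2) (dV s).
      by rewrite -[dV s]addr0; exact: (is_deriveD dVs (is_derive_cst _ _ _)).
    have := @is_derive1_comp _ Num.sqrt (fun x => V x + e ^+ 2) s _ _
      (is_derive1_sqrt (Ve s)) dVes.
    by rewrite mulrC.
  have dEs : is_derive s 1 (fun x => expR (c * x)) (c * expR (c * s)).
    have dcs : is_derive s 1 (fun x : R => c * x) c.
      rewrite -[X in is_derive _ _ _ X]mulr1; exact: (is_deriveZ c (is_derive_id _ _)).
    have := @is_derive1_comp _ expR (fun x => c * x) s _ _ (is_derive_expR _) dcs.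
    by rewrite mulrC.
  have dWcs : is_derive s 1 (fun x => W x - (G / c + e)) (dV s / (2 * W s)).
    rewrite -[X in is_derive _ _ _ X]subr0.
    exact: (is_deriveB dWs (is_derive_cst _ _ _)).
  apply: is_derive_eq (is_deriveM dEs dWcs) _.
  by rewrite /dF /= /GRing.scale /=; ring.
have cF : {within `[0, t], continuous F}.
  have {}cV := within_ge0_segment V t cV.
  have cexp : {within `[0, t], continuous (fun x => expR (c * x))}.
    apply: continuous_subspaceT => x; apply: continuous_comp.
      by apply: continuousM; [exact: cst_continuous|exact: cvg_id].
    exact: continuous_expR.
  have cW : {within `[0, t], continuous W}.
    have cVe : {within `[0, t], continuous (V + cst (e ^+ 2))}.
      by apply: within_continuousD => // s; exact: cst_continuous.
    move=> s; exact: (@continuous_comp _ _ _ (V + cst (e ^+ 2) : subspace _ -> R)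
      Num.sqrt s (cVe s) (@sqrt_continuous R _)).
  have cWk : {within `[0, t], continuous (fun x => W x - (G / c + e))}.
    apply: (@within_continuousB _ _ _ _ W (cst (G / c + e)) cW) => s.
    exact: cst_continuous.
  by move=> s; exact: continuousM (cexp s) (cWk s).
have dF_le0 s : 0 < s < t -> dF s <= 0.
  move=> st; rewrite /dF pmulr_rle0 ?expR_gt0 //.
  have dVW : dV s / (2 * W s) <= G - c * (V s / W s).
    rewrite ler_pdivrMr ?mulr_gt0 //; apply: le_trans (dV_le s st) _.
    rewrite mulrCA ler_pM2l // mulrBl mulrA divfK ?gt_eqF // lerB //.
    by rewrite ler_wpM2l.
  have VWs : V s / W s = W s - e * (e / W s).
    by rewrite -[V s](addrK (e ^+ 2)) -W2; field; rewrite gt_eqF.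
  have eW : e * (e / W s) <= e * 1.
    by rewrite ler_pM2l // ler_pdivrMr // mul1r.
  rewrite VWs in dVW; have := ler_wpM2l (ltW c0) eW.
  have : c * (G / c) = G by rewrite mulrC divfK // gt_eqF.
  nra.
have Ft0 : F t <= F 0.
  have [->//|tn0] := eqVneq t 0.
  have tp : 0 < t by rewrite lt0r tn0.
  have [s sI FE] := MVT tp dFE cF.
  by rewrite -subr_le0 FE pmulr_lle0 ?subr0 // dF_le0 // -in_itv.
have := ler_wpM2l (expR_ge0 (- (c * t))) Ft0.
rewrite /F mulrA -expRD addNr expR0 mulr0 expR0 !mul1r.
set E := expR _ => Wt.
have E1 : E <= 1 by rewrite -expR0 ler_expR oppr_le0 mulr_ge0 // ltW.
have E0 : 0 <= E := expR_ge0 _.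
have k0 : 0 <= G / c by rewrite divr_ge0 // ltW.
have -> : e2 = e + e by rewrite /e; field.
have := ler_wpM2l E0 (WV 0); have := VW t; have := mulr_ge0 E0 k0.
have := ler_wpM2r (ltW e0) E1; nra.
Qed.

(** * Energy estimate for the tracking errors *)

Lemma dotB_sqr {R : realType} {n : nat} (p q : R) (x y : 'rV[R]_n) :
  dot (p *: x - q *: y) (p *: x - q *: y) =
  p ^+ 2 * dot x x - 2 * p * q * dot x y + q ^+ 2 * dot y y.
Proof.
rewrite -scaleNr !(dotDr, dotDl, dotZl, dotZr) (dotC y x); ring.
Qed.

(** Cauchy-Schwarz for the concatenated vectors [(a, b)] and [(u, v)]: the sum
    [|p a - q u|^2 + |p b - q v|^2] equals [p * (p * (|a|^2 + |b|^2) - q ^+ 2)]. *)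
Lemma cauchy_schwarz_pair {R : realType} {n : nat} (a b u v : 'rV[R]_n) :
  (dot a u + dot b v) ^+ 2 <= (dot u u + dot v v) * (dot a a + dot b b).
Proof.
set p := dot u u + dot v v; set q := dot a u + dot b v.
have p0 : 0 <= p by rewrite addr_ge0 ?dot_ge0.
have [pz|pn0] := eqVneq p 0.
  have u0 := dot_ge0 u; have v0 := dot_ge0 v; rewrite /p in pz.
  have uz : u = 0 by apply: dot_eq0; lra.
  have vz : v = 0 by apply: dot_eq0; lra.
  rewrite /p pz mul0r /q uz vz -(scale0r 0) !dotZr !mul0r addr0 expr0n //.
have pp : 0 < p by rewrite lt0r pn0.
rewrite -subr_ge0 -(pmulr_rge0 _ pp).
have := addr_ge0 (dot_ge0 (p *: a - q *: u)) (dot_ge0 (p *: b - q *: v)).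
rewrite !dotB_sqr => /le_trans; apply; rewrite le_eqVlt; apply/orP; left; apply/eqP.
transitivity (p ^+ 2 * (dot a a + dot b b) - 2 * p * q * (dot a u + dot b v)
  + q ^+ 2 * (dot u u + dot v v)).
  by ring.
by rewrite -/p -/q; ring.
Qed.

Lemma sum_row {R : realType} {n : nat} (x : 'I_n -> R) :
  \sum_i (\row_i x i) 0 i = \sum_i x i.
Proof. by apply: eq_bigr => i _; rewrite mxE. Qed.

Lemma dot_row {R : realType} {n : nat} (x y : 'I_n -> R) :
  dot (\row_i x i) (\row_i y i) = \sum_i x i * y i.
Proof. by apply: eq_bigr => i _; rewrite !mxE. Qed.

(** The diffusion term is minus the Laplacian applied to [x], so it preserves totals. *)
Lemma sum_diffusion {R : realType} {n : nat} (A : 'M[R]_n) (x : 'I_n -> R) :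
  undirected_adjacency A -> \sum_i \sum_j A i j * (x j - x i) = 0.
Proof.
move=> Aund; apply: oppr_inj; rewrite oppr0.
rewrite -[RHS](sum_mul_laplacian A (\row_i x i) Aund) -sumrN.
apply: eq_bigr => i _; rewrite mul_laplacian // -sumrN; apply: eq_bigr => j _.
by rewrite !mxE (Aund.2 j i) -mulrN opprB.
Qed.

Lemma dot_diffusion {R : realType} {n : nat} (A : 'M[R]_n) (x : 'I_n -> R) :
  undirected_adjacency A ->
  \sum_i x i * (\sum_j A i j * (x j - x i)) =
  - dot (\row_i x i *m laplacian A) (\row_i x i).
Proof.
move=> Aund; rewrite /dot -sumrN; apply: eq_bigr => i _.
rewrite mul_laplacian // mulrC mxE -mulNr -sumrN; congr (_ * _).
by apply: eq_bigr => j _; rewrite !mxE (Aund.2 j i) -mulrN opprB.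
Qed.

(* In the inner product with the errors, which sum to zero, the common drift
   of the reference average disappears. *)
Lemma error_energy_rate {R : realType} {n : nat} (A : 'M[R]_n)
    (kappa l c M d : R) (a b u v : 'I_n -> R) :
  (0 < n)%N -> undirected_adjacency A -> 0 < kappa ->
  (forall w : 'rV_n, \sum_i w 0 i = 0 ->
    l * dot w w <= dot (w *m laplacian A) w) ->
  0 < l -> c < 1 -> (l + 1 - c) * (1 - c) = 1 ->
  \sum_i a i + \sum_i b i = 0 ->
  (forall i, `|u i| <= M /\ `|v i| <= M) -> 0 <= M ->
  \sum_i (2 * a i * (u i + kappa * (\sum_j A i j * (a j - a i))
                     + kappa * (b i - a i) - d)
          + 2 * b i * (v i + kappa * (a i - b i) - d)) <=
  2 * (Num.sqrt (n + n)%:R * M * Num.sqrt (\sum_i (a i ^+ 2 + b i ^+ 2))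
       - kappa * c * \sum_i (a i ^+ 2 + b i ^+ 2)).
Proof.
move=> n0 Aund k0 gap l0 c1 cE ab0 uvM M0.
have VE : \sum_i (a i ^+ 2 + b i ^+ 2) =
    dot (\row_i a i) (\row_i a i) + dot (\row_i b i) (\row_i b i).
  by rewrite !dot_row -big_split.
have := coupled_form_ge A l c (\row_i a i) (\row_i b i) n0 Aund gap l0 c1 cE.
rewrite !sum_row => /(_ ab0); rewrite -VE.
have := cauchy_schwarz_pair (\row_i a i) (\row_i b i) (\row_i u i) (\row_i v i).
rewrite -VE => cs form.
(* Each of the [2n] inputs is at most [M] in absolute value; this is the origin of
   [Num.sqrt (n + n)%:R]. *)
have uv_le : dot (\row_i u i) (\row_i u i) + dot (\row_i v i) (\row_i v i)
    <= (n + n)%:R * M ^+ 2.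
  rewrite natrD mulrDl !dot_row -[n in leRHS]card_ord.
  have sq_le (w : 'I_n -> R) : (forall i, `|w i| <= M) ->
      \sum_i w i * w i <= n%:R * M ^+ 2.
    move=> wM; apply: le_trans (_ : \sum_(i < n) M ^+ 2 <= _); last first.
      by rewrite sumr_const card_ord mulr_natl.
    apply: ler_sum => i _; rewrite -expr2 -real_normK ?num_real //.
    by rewrite ler_pXn2r ?nnegrE.
  by rewrite lerD // card_ord sq_le // => i; have [] := uvM i.
set V := \sum_i _ in cs form *.
have V0 : 0 <= V by apply: sumr_ge0 => i _; rewrite addr_ge0 ?sqr_ge0.
have force : dot (\row_i a i) (\row_i u i) + dot (\row_i b i) (\row_i v i)
    <= Num.sqrt (n + n)%:R * M * Num.sqrt V.
  apply: le_trans (ler_norm _) _; rewrite -sqrtr_sqr.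
  apply: le_trans (_ : Num.sqrt ((n + n)%:R * M ^+ 2 * V) <= _).
    by rewrite ler_wsqrtr // (le_trans cs) // ler_wpM2r.
  rewrite sqrtrM ?mulr_ge0 ?sqr_ge0 ?ler0n //.
  by rewrite sqrtrM ?ler0n // sqrtr_sqr ger0_norm.
have -> : \sum_i (2 * a i * (u i + kappa * (\sum_j A i j * (a j - a i))
                     + kappa * (b i - a i) - d)
          + 2 * b i * (v i + kappa * (a i - b i) - d)) =
  2 * (dot (\row_i a i) (\row_i u i) + dot (\row_i b i) (\row_i v i)
    - kappa * (dot (\row_i a i *m laplacian A) (\row_i a i)
               + dot (\row_i a i - \row_i b i) (\row_i a i - \row_i b i))).
  have -> : \row_i a i - \row_i b i = \row_i (a i - b i).
    by apply/rowP => i; rewrite !mxE.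
  transitivity (2 * (\sum_i a i * u i + \sum_i b i * v i
     + kappa * (\sum_i a i * (\sum_j A i j * (a j - a i)))
     - kappa * (\sum_i (a i - b i) * (a i - b i)) - d * (\sum_i (a i + b i)))).
    rewrite !mulr_sumr -!big_split /= -!sumrB mulr_sumr.
    by apply: eq_bigr => i _ /=; ring.
  by rewrite big_split /= ab0 dot_diffusion // !dot_row; ring.
rewrite ler_pM2l // lerB // -mulrA ler_pM2l //.
Qed.

(** Scalar signals suffice, since the dynamics decouple over the [m] components. Inputs are bounded
    on [[0, t]] only, so the estimate at [t] involves past inputs alone. *)
Lemma tracking_estimate {R : realType} {n : nat} (A : 'M[R]_n)
    (kappa l c M t : R) (r f fa fb xa xb : 'I_n -> R -> R) :
  (0 < n)%N -> undirected_adjacency A -> 0 < kappa ->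
  (forall w : 'rV_n, \sum_i w 0 i = 0 ->
    l * dot w w <= dot (w *m laplacian A) w) ->
  0 < l -> 0 < c -> c < 1 -> (l + 1 - c) * (1 - c) = 1 ->
  (forall i, {within [set s : R | 0 <= s], continuous (r i)}) ->
  (forall i (s : R), 0 < s -> is_derive s 1 (r i) (f i s)) ->
  (forall i, xa i 0 + xb i 0 = 2 * r i 0) ->
  (forall i (s : R), 0 <= s -> fa i s + fb i s = 2 * f i s) ->
  (forall i, {within [set s : R | 0 <= s], continuous (xa i)}) ->
  (forall i, {within [set s : R | 0 <= s], continuous (xb i)}) ->
  (forall i (s : R), 0 < s -> is_derive s 1 (xa i)
    (fa i s + kappa * (\sum_j A i j * (xa j s - xa i s))
            + kappa * (xb i s - xa i s))) ->
  (forall i (s : R), 0 < s -> is_derive s 1 (xb i)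
    (fb i s + kappa * (xa i s - xb i s))) ->
  0 <= t -> 0 <= M ->
  (forall i (s : R), 0 <= s <= t -> `|fa i s| <= M /\ `|fb i s| <= M) ->
  let avg s := n%:R^-1 * \sum_j r j s in
  let V s := \sum_i ((xa i s - avg s) ^+ 2 + (xb i s - avg s) ^+ 2) in
  (Num.sqrt (V t) <= expR (- (kappa * c * t)) * Num.sqrt (V 0)
                     + Num.sqrt (n + n)%:R * M / (kappa * c) : Prop).
Proof.
move=> n0 Aund k0 gap l0 c0 c1 cE cr dr x0 fab cxa cxb dxa dxb t0 M0 fM avg V.
have nR : n%:R != 0 :> R by rewrite pnatr_eq0 -lt0n.
pose a i s := xa i s - avg s; pose b i s := xb i s - avg s.
pose d s := n%:R^-1 * \sum_j f j s.
have avgE s : n%:R * avg s = \sum_j r j s by rewrite mulVKf.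
have dE s : n%:R * d s = \sum_j f j s by rewrite mulVKf.
pose da i s := fa i s + kappa * (\sum_j A i j * (a j s - a i s))
               + kappa * (b i s - a i s) - d s.
pose db i s := fb i s + kappa * (a i s - b i s) - d s.
have davg (s : R) : 0 < s -> is_derive s 1 avg (d s).
  move=> s0; apply: (is_deriveZ (n%:R^-1) (is_derive_bigsum _ _ _ _)) => i.
  exact: dr.
(* Subtracting the common average leaves all differences unchanged, so the errors obey the same
   equations with the extra drift [- d]. *)
have daE i (s : R) : 0 < s -> is_derive s 1 (a i) (da i s).
  move=> s0; apply: is_derive_eq (is_deriveB (dxa i s s0) (davg s s0)) _.
  rewrite /da /a /b; congr (_ + kappa * _ + kappa * _ - _); last by ring.
  by apply: eq_bigr => j _; congr (_ * _); ring.
have dbE i (s : R) : 0 < s -> is_derive s 1 (b i) (db i s).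
  move=> s0; apply: is_derive_eq (is_deriveB (dxb i s s0) (davg s s0)) _.
  by rewrite /db /a /b; congr (_ + kappa * _ - _); ring.
have cavg : {within [set s : R | 0 <= s], continuous avg}.
  have csum := within_continuous_sum _ _ cr.
  by move=> s; apply: continuousM (csum s); exact: cst_continuous.
have ca i : {within [set s : R | 0 <= s], continuous (a i)}.
  exact: within_continuousB (cxa i) cavg.
have cb i : {within [set s : R | 0 <= s], continuous (b i)}.
  exact: within_continuousB (cxb i) cavg.
have sumab (s : R) : 0 <= s -> \sum_i a i s + \sum_i b i s = 0.
  move=> s0; rewrite -big_split.
  pose Z u := \sum_i (a i u + b i u).
  have Z0 : Z 0 = 0.
    rewrite /Z /a /b (eq_bigr (fun i => 2 * r i 0 - 2 * avg 0)).
      rewrite sumrB -mulr_sumr sumr_const card_ord -[X in _ - X]mulr_natl.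
      by rewrite mulrCA avgE subrr.
    by move=> i _; rewrite -x0; ring.
  have cZ : {within `[0, s], continuous Z}.
    apply: within_ge0_segment; apply: within_continuous_sum => i.
    exact: within_continuousD (ca i) (cb i).
  have dZ (u : R) : u \in `]0, s[%R -> is_derive u 1 Z 0.
    rewrite in_itv /= => /andP[u0 _].
    have := is_derive_bigsum _ _ u
      (fun i => is_deriveD (daE i u u0) (dbE i u u0)).
    have -> // : \sum_i (da i u + db i u) = 0.
    (* The exchange between [a i] and [b i] cancels, diffusion sums to zero, and the inputs balance
       the drift since [n%:R * d u] is the sum of the [f i u]. *)
    transitivity (\sum_i 2 * f i u
      + kappa * (\sum_i \sum_j A i j * (a j u - a i u)) - \sum_(i < n) 2 * d u).
      rewrite mulr_sumr -big_split -sumrB; apply: eq_bigr => i _ /=.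
      by rewrite -fab ?ltW // /da /db; ring.
    rewrite sum_diffusion // mulr0 addr0 -mulr_sumr sumr_const card_ord.
    by rewrite -[X in _ - X]mulr_natl mulrCA dE subrr.
  have [u _ ZE] := MVT_segment s0 dZ cZ.
  by move: ZE; rewrite Z0 mul0r subr0.
apply: (@sqrt_decay _ V (fun s => \sum_i (2 * a i s * da i s + 2 * b i s * db i s))).
- by rewrite mulr_gt0.
- by rewrite mulr_ge0 // sqrtr_ge0.
- by [].
- by move=> s; apply: sumr_ge0 => i _; rewrite addr_ge0 ?sqr_ge0.
- apply: within_continuous_sum => i.
  have caa : {within [set s : R | 0 <= s], continuous (fun s => a i s ^+ 2)}.
    by move=> s; exact: continuousM (ca i s) (ca i s).
  have cbb : {within [set s : R | 0 <= s], continuous (fun s => b i s ^+ 2)}.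
    by move=> s; exact: continuousM (cb i s) (cb i s).
  exact: within_continuousD caa cbb.
- move=> s /andP[s0 _]; apply: is_derive_bigsum => i.
  have da_ := daE i s s0; have db_ := dbE i s s0.
  apply: is_derive_eq (is_deriveD (is_deriveM da_ da_) (is_deriveM db_ db_)) _.
  by rewrite /GRing.scale /=; ring.
move=> s /andP[s0 st].
have uvM i : `|fa i s| <= M /\ `|fb i s| <= M by apply: fM; rewrite !ltW.
exact: (error_energy_rate A kappa l c M (d s) (a^~ s) (b^~ s) _ _ n0 Aund k0 gap
  l0 c1 cE (sumab s (ltW s0)) uvM M0).
Qed.

(** * Input-to-state stability and ultimate bounds *)

Lemma classK_linear {R : realType} (a : R) : 0 < a -> classK (fun x => a * x).
Proof.
move=> a0; split; first by rewrite mulr0.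
split=> [|x y _ xy]; last by rewrite ltr_pM2l.
apply: continuous_subspaceT => x.
by apply: continuousM; [exact: cst_continuous|exact: cvg_id].
Qed.

Theorem theorem2 (R : realType) (n m : nat) (A : 'M[R]_n) (kappa l2 : R) :
  (1 < n)%N ->
  undirected_adjacency A -> connected_graph A ->
  second_smallest_eigenvalue (laplacian A) l2 ->
  0 < kappa ->
  let c := kappa / 2 * (l2 + 2 - Num.sqrt (l2 ^+ 2 + 4)) in
  (* uniform ISS gain constants, with exponential decay rate c *)
  exists (K : R) (gamma : R -> R), 0 <= K /\ classK gamma /\
  forall (r f fa fb xa xb : 'I_n -> 'I_m -> R -> R)
         (ra0 rb0 : 'I_n -> 'I_m -> R),
    (* bounded reference signals with bounded derivative f *)
    (exists B, forall (i : 'I_n) (k : 'I_m) (t : R), 0 <= t -> `|r i k t| <= B) ->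
    (exists B, forall (i : 'I_n) (k : 'I_m) (t : R), 0 <= t -> `|f i k t| <= B) ->
    (forall i k, {within [set t : R | 0 <= t], continuous (r i k)}) ->
    (forall (i : 'I_n) (k : 'I_m) (t : R), 0 < t -> is_derive t 1 (r i k) (f i k t)) ->
    (* decomposition of the data *)
    (forall i k, ra0 i k + rb0 i k = 2 * r i k 0) ->
    (exists B, forall (i : 'I_n) (k : 'I_m) (t : R), 0 <= t -> `|fa i k t| <= B /\ `|fb i k t| <= B) ->
    (forall (i : 'I_n) (k : 'I_m) (t : R), 0 <= t -> fa i k t + fb i k t = 2 * f i k t) ->
    (* sub-state dynamics *)
    (forall i k, {within [set t : R | 0 <= t], continuous (xa i k)}) ->
    (forall i k, {within [set t : R | 0 <= t], continuous (xb i k)}) ->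
    (forall (i : 'I_n) (k : 'I_m) (t : R), 0 < t -> is_derive t 1 (xa i k)
        (fa i k t + kappa * (\sum_(j < n) A i j * (xa j k t - xa i k t))
                  + kappa * (xb i k t - xa i k t))) ->
    (forall (i : 'I_n) (k : 'I_m) (t : R), 0 < t -> is_derive t 1 (xb i k)
        (fb i k t + kappa * (xa i k t - xb i k t))) ->
    (forall i k, xa i k 0 = ra0 i k) ->
    (forall i k, xb i k 0 = rb0 i k) ->
    let E0 := \big[Num.max/0]_(j < n) \big[Num.max/0]_(k < m)
                Num.max `|ra0 j k - ravg r k 0| `|rb0 j k - ravg r k 0| in
    (* the sub-states stay bounded *)
    (exists B, forall (i : 'I_n) (k : 'I_m) (t : R), 0 <= t -> `|xa i k t| <= B /\ `|xb i k t| <= B) /\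
    (* ISS estimate of the tracking errors w.r.t. the inputs fa, fb,
       with decay rate c *)
    (forall (t M : R), 0 <= t ->
       (forall (i : 'I_n) (k : 'I_m) (s : R), 0 <= s <= t -> `|fa i k s| <= M /\ `|fb i k s| <= M) ->
       forall i k,
         `|xa i k t - ravg r k t| <= K * expR (- (c * t)) * E0 + gamma M /\
         `|xb i k t - ravg r k t| <= K * expR (- (c * t)) * E0 + gamma M) /\
    (* ultimate boundedness of the tracking errors *)
    (exists b : R, forall eps : R, 0 < eps -> exists T : R, forall t, T <= t ->
       forall i k, `|xa i k t - ravg r k t| <= b + eps /\
                   `|xb i k t - ravg r k t| <= b + eps).
Proof.
move=> n_gt1 Aund Acon l2P k0 c.
have n0 : (0 < n)%N := ltnW n_gt1.
have [l0 gap] := laplacian_spectral_gap A l2 n_gt1 Aund Acon l2P.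
have [] := coupling_rate_spec l2 l0; set c' := (_ / 2) => c'0 c'1 c'E.
(* [c'] is the rate for unit coupling, and [kappa] scales the whole form. *)
have cE : c = kappa * c' by rewrite /c /c'; ring.
have c0 : 0 < c by rewrite cE mulr_gt0.
(* [K] converts a uniform bound on [2n] scalars into a Euclidean one, both for the initial errors
   and for the inputs; for the latter, division by the rate [c] yields the gain. *)
pose K : R := Num.sqrt (n + n)%:R.
have K0 : 0 < K by rewrite sqrtr_gt0 ltr0n addn_gt0 n0.
exists K, (fun x => K / c * x); split; first exact: ltW.
split; first by apply: classK_linear; rewrite divr_gt0.
move=> r f fa fb xa xb ra0 rb0 [Br rB] _ cr dr rab0 [Bf fB] fab cxa cxb dxa dxb
  xa0 xb0 E0.
have E0_ge0 : 0 <= E0 by exact: bigmax_ge_id.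
have E0_le j k : `|ra0 j k - ravg r k 0| <= E0 /\ `|rb0 j k - ravg r k 0| <= E0.
  have : Num.max `|ra0 j k - ravg r k 0| `|rb0 j k - ravg r k 0| <= E0.
    apply: le_trans (le_bigmax _ _ j).
    exact: (le_bigmax _ (fun k =>
      Num.max `|ra0 j k - ravg r k 0| `|rb0 j k - ravg r k 0|) k).
  by rewrite ge_max => /andP[].
have est (t M : R) : 0 <= t ->
    (forall (i : 'I_n) (k : 'I_m) (s : R), 0 <= s <= t ->
      `|fa i k s| <= M /\ `|fb i k s| <= M) ->
    forall i k,
      `|xa i k t - ravg r k t| <= K * expR (- (c * t)) * E0 + K / c * M /\
      `|xb i k t - ravg r k t| <= K * expR (- (c * t)) * E0 + K / c * M.
  move=> t0 fM i k.
  have M0 : 0 <= M.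
    by have [] := fM i k 0; rewrite ?lexx // => /(le_trans (normr_ge0 _)).
  pose V s := \sum_i ((xa i k s - ravg r k s) ^+ 2 + (xb i k s - ravg r k s) ^+ 2).
  have VK : Num.sqrt (V t) <= expR (- (c * t)) * Num.sqrt (V 0) + K * M / c.
    rewrite cE; apply: (tracking_estimate A kappa l2 c' M t
      (fun i => r i k) (fun i => f i k) (fun i => fa i k) (fun i => fb i k)
      (fun i => xa i k) (fun i => xb i k)) => // [j|j s|j s].
    - by rewrite xa0 xb0 rab0.
    - exact: fab.
    - exact: fM.
  have V0 : Num.sqrt (V 0) <= K * E0.
    rewrite -[E0]ger0_norm // -sqrtr_sqr -sqrtrM ?ler0n // ler_wsqrtr //.
    rewrite natrD mulrDl /V big_split /=.
    have sq_le (w : 'I_n -> R) : (forall i, `|w i| <= E0) ->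
        \sum_i w i ^+ 2 <= n%:R * E0 ^+ 2.
      move=> wE; apply: le_trans (_ : \sum_(i < n) E0 ^+ 2 <= _); last first.
        by rewrite sumr_const card_ord mulr_natl.
      apply: ler_sum => j _; rewrite -real_normK ?num_real //.
      by rewrite ler_pXn2r ?nnegrE.
    by rewrite lerD // sq_le // => j; rewrite ?xa0 ?xb0; have [] := E0_le j k.
  have Vt_le : Num.sqrt (V t) <= K * expR (- (c * t)) * E0 + K / c * M.
    apply: le_trans VK _; rewrite [K * M / c]mulrAC lerD2r.
    by rewrite -mulrA mulrCA; apply: ler_wpM2l => //; exact: expR_ge0.
  have V_ge (x y : R) (z : R) : x ^+ 2 + y ^+ 2 <= z -> 
      `|x| <= Num.sqrt z /\ `|y| <= Num.sqrt z.
    move=> xyz; split; rewrite -sqrtr_sqr ler_wsqrtr // (le_trans _ xyz) //.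
      by rewrite lerDl sqr_ge0.
    by rewrite lerDr sqr_ge0.
  have [] := V_ge (xa i k t - ravg r k t) (xb i k t - ravg r k t) (V t).
    rewrite /V (bigD1 i) //= lerDl; apply: sumr_ge0 => j _.
    by rewrite addr_ge0 ?sqr_ge0.
  by move=> xaV xbV; split; apply: le_trans Vt_le.
have est_Bf t : 0 <= t -> forall i k,
      `|xa i k t - ravg r k t| <= K * expR (- (c * t)) * E0 + K / c * Bf /\
      `|xb i k t - ravg r k t| <= K * expR (- (c * t)) * E0 + K / c * Bf.
  by move=> t0; apply: est => // i k s /andP[s0 _]; exact: fB.
split; last split => //.
(* A sub-state is its error plus the reference average, and the exponential is at most 1. *)
- exists (K * E0 + K / c * Bf + Br) => i k t t0.
  have avg_le : `|ravg r k t| <= Br.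
    rewrite /ravg normrM ger0_norm ?invr_ge0 ?ler0n // ler_pdivrMl ?ltr0n //.
    apply: le_trans (ler_norm_sum _ _ _) _.
    apply: le_trans (ler_sum _ _) _; first by move=> j _; exact: rB.
    by rewrite sumr_const card_ord mulr_natl.
  have Kexp : K * expR (- (c * t)) * E0 <= K * E0.
    rewrite ler_wpM2r // ler_piMr ?(ltW K0) // -expR0 ler_expR oppr_le0.
    by rewrite mulr_ge0 // ltW.
  have tri (x : R) : `|x - ravg r k t| <= K * expR (- (c * t)) * E0 + K / c * Bf ->
      `|x| <= K * E0 + K / c * Bf + Br.
    move=> xle; rewrite -[x](subrK (ravg r k t)).
    by rewrite (le_trans (ler_normD _ _)) // lerD // (le_trans xle) // lerD2r.
  by have [/tri xab /tri xbb] := est_Bf t t0 i k.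
(* This time comes from [1 + c * t <= expR (c * t)]: once [K * E0 <= eps * c * t], the transient is
   at most [eps]. *)
- exists (K / c * Bf) => eps eps0; exists (K * E0 / (eps * c)) => t Tt i k.
  have t0 : 0 <= t.
    by apply: le_trans Tt; rewrite divr_ge0 // mulr_ge0 // ltW.
  have decay : K * expR (- (c * t)) * E0 <= eps.
    rewrite expRN mulrAC ler_pdivrMr ?expR_gt0 //.
    move: Tt; rewrite (ler_pdivrMr _ _ (mulr_gt0 eps0 c0)) => /le_trans; apply.
    rewrite mulrCA ler_pM2l // [t * c]mulrC.
    by apply: le_trans (expR_ge1Dx _); rewrite lerDr.
  have [xa_le xb_le] := est_Bf t t0 i k.
  by split; [apply: le_trans xa_le _|apply: le_trans xb_le _]; rewrite addrC lerD2l.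
Qed.
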